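(* Let $\mathcal{T}=(S,s_{\mathit{init}},\to,L)$ be a finite transition system, $E$ a set of terminal states, and $C$ a set of states disjoint from $E$. Let $\Phi=\Diamond E$ or $\Phi=\Box\neg E$, and let $\pi=s_0\dots s_n$ be a finite maximal path visiting $C$ and satisfying $\Phi$. Then it is decidable in polynomial time whether $C$ is a $d_{\mathit{gHamm}}$-counterfactual cause for $\Phi$ on $\pi$.
   Context: A transition system is $\mathcal{T}=(S,s_{\mathit{init}},\to,L)$ with finite states $S$, initial state $s_{\mathit{init}}$, transitions $\to\subseteq S\times S$, labeling $L\colon S\to2^{\mathsf{AP}}$. Paths start in $s_{\mathit{init}}$ and follow transitions; traces are sequences of labels; terminal states have no outgoing transitions; maximal paths are infinite or end in a terminal state. For a distance function $d$ on maximal paths, $C$ is a $d$-counterfactual cause for $\Phi$ on $\pi$ (where $\pi$ visits $C$ and satisfies $\Phi$) if (1) some maximal path avoids $C$, and (2) every maximal path $\rho\models\Box\neg C$ with minimal $d(\pi,\rho)$ among maximal paths avoiding $C$ satisfies $\neg\Phi$. Hamming distance of equal-length words: number of positions at which they differ. Generalized Hamming distance of words $w=w_1\dots w_n$, $v=v_1\dots v_m$: $d_{\mathit{gHamm}}(w,v)=d_{\mathit{Hamm}}(w,v_{[1:n]})+(m-n)$ if $n\le m$, and $d_{\mathit{Hamm}}(w_{[1:m]},v)+(n-m)$ otherwise; on paths it is applied to their traces. *)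

(* Defs.v *)
From mathcomp Require Import all_boot.

Set Implicit Arguments.
Unset Strict Implicit.
Unset Printing Implicit Defensive.

(* Finite or infinite words; used both for paths and for traces. *)
Inductive word (A : Type) : Type :=
| Fin of seq A
| Inf of (nat -> A).

Definition letter A (w : word A) (i : nat) : option A :=
  match w with Fin u => onth u i | Inf f => Some (f i) end.

Definition map_word A B (h : A -> B) (w : word A) : word B :=
  match w with Fin u => Fin (map h u) | Inf f => Inf (h \o f) end.

(* Only meaningful on words of equal length. *)
Definition hamming (A : eqType) (w v : seq A) : nat :=
  count (fun p => p.1 != p.2) (zip w v).

Definition gen_hamming (A : eqType) (w v : seq A) : nat :=
  if size w <= size v then hamming w (take (size w) v) + (size v - size w)
  else hamming (take (size v) w) v + (size w - size v).

(* Natural numbers extended with an infinite value, None. *)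
Definition enat : Type := option nat.

Definition enat_le (x y : enat) : bool :=
  match x, y with
  | _, None => true
  | None, Some _ => false
  | Some m, Some n => m <= n
  end.

(* A finite and an infinite word are at infinite distance, since the difference
   of their lengths is infinite. The distance between two infinite words is a
   dummy value: below, the first argument is always finite. *)
Definition d_gHamm_word (A : eqType) (w v : word A) : enat :=
  match w, v with
  | Fin w', Fin v' => Some (gen_hamming w' v')
  | _, _ => None
  end.

Record transition_system (S AP : finType) : Type := TransitionSystem {
  init : S;
  trans : rel S;
  label : S -> {set AP}
}.

Definition terminal (S AP : finType) (T : transition_system S AP) : {set S} :=
  [set s | [forall t, ~~ trans T s t]].

Definition maximal_path (S AP : finType) (T : transition_system S AP)
    (rho : word S) : Prop :=
  match rho with
  | Fin [::] => False
  | Fin (s :: p) =>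
      [/\ s = init T, path (trans T) s p & last s p \in terminal T]
  | Inf f => f 0 = init T /\ forall i, trans T (f i) (f i.+1)
  end.

Definition trace (S AP : finType) (T : transition_system S AP) (rho : word S) :
  word {set AP} := map_word (label T) rho.

Definition eventually (S : finType) (A : {set S}) (rho : word S) : Prop :=
  exists i s, letter rho i = Some s /\ s \in A.

Definition always (S : finType) (A : {set S}) (rho : word S) : Prop :=
  forall i s, letter rho i = Some s -> s \in A.

Definition d_gHamm (S AP : finType) (T : transition_system S AP)
  (pi rho : word S) : enat := d_gHamm_word (trace T pi) (trace T rho).

(* To be used when the maximal path pi visits C and satisfies Phi. *)
Definition counterfactual_cause (S AP : finType) (T : transition_system S AP)
    (d : word S -> word S -> enat) (C : {set S}) (Phi : word S -> Prop)
    (pi : word S) : Prop :=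
  let avoiding rho := maximal_path T rho /\ always (~: C) rho in
  (exists rho, avoiding rho) /\
  (forall rho, avoiding rho ->
     (forall rho', avoiding rho' -> enat_le (d pi rho) (d pi rho')) ->
     ~ Phi rho).

Inductive objective : Type := Reachability | Safety.

Definition property (o : objective) (S : finType) (E : {set S}) :
    word S -> Prop :=
  match o with
  | Reachability => eventually E
  | Safety => always (~: E)
  end.

(* The machine model is the imperative language WHILE of N. D. Jones
   (Computability and Complexity from a Programming Perspective, MIT Press,
   1997), which computes on binary trees and has the same polynomial-time
   decidable problems as Turing machines. A tree is thought of as a pointer, so
   that every operation below, including cons, takes constant time and creates
   at most one new memory cell. In particular there is no unit-cost comparison
   of trees: a test only distinguishes Nil from a pair. *)

Inductive tree : Type := Nil | Cons of tree & tree.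

Fixpoint tree_size (t : tree) : nat :=
  match t with Nil => 1 | Cons a b => (tree_size a + tree_size b).+1 end.

Definition tree_hd (t : tree) : tree := if t is Cons a _ then a else Nil.
Definition tree_tl (t : tree) : tree := if t is Cons _ b then b else Nil.
Definition is_pair (t : tree) : bool := if t is Cons _ _ then true else false.

Inductive expr : Type :=
| EVar of nat
| ENil
| ECons of expr & expr
| EHd of expr
| ETl of expr.

Inductive cmd : Type :=
| Assign of nat & expr
| Seq of cmd & cmd
| If of expr & cmd & cmd
| While of expr & cmd.

Definition store : Type := nat -> tree.

Definition update (sigma : store) (x : nat) (t : tree) : store :=
  fun y => if y == x then t else sigma y.

Fixpoint eval (sigma : store) (e : expr) : tree :=
  match e with
  | EVar x => sigma x
  | ENil => Nil
  | ECons a b => Cons (eval sigma a) (eval sigma b)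
  | EHd a => tree_hd (eval sigma a)
  | ETl a => tree_tl (eval sigma a)
  end.

Fixpoint expr_cost (e : expr) : nat :=
  match e with
  | EVar _ | ENil => 1
  | ECons a b => (expr_cost a + expr_cost b).+1
  | EHd a | ETl a => (expr_cost a).+1
  end.

(* exec c sigma n tau: started in sigma, the command c halts in tau after
   exactly n steps. *)
Inductive exec : cmd -> store -> nat -> store -> Prop :=
| ExecAssign x e sigma :
    exec (Assign x e) sigma (expr_cost e).+1 (update sigma x (eval sigma e))
| ExecSeq c1 c2 sigma1 sigma2 sigma3 n1 n2 :
    exec c1 sigma1 n1 sigma2 -> exec c2 sigma2 n2 sigma3 ->
    exec (Seq c1 c2) sigma1 (n1 + n2) sigma3
| ExecIf e c1 c2 sigma tau n :
    exec (if is_pair (eval sigma e) then c1 else c2) sigma n tau ->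
    exec (If e c1 c2) sigma ((expr_cost e).+1 + n) tau
| ExecWhileStop e c sigma :
    ~~ is_pair (eval sigma e) ->
    exec (While e c) sigma (expr_cost e).+1 sigma
| ExecWhileLoop e c sigma1 sigma2 sigma3 n1 n2 :
    is_pair (eval sigma1 e) ->
    exec c sigma1 n1 sigma2 -> exec (While e c) sigma2 n2 sigma3 ->
    exec (While e c) sigma1 ((expr_cost e).+1 + n1 + n2) sigma3.

(* The input is read from variable 0, all other variables being Nil initially;
   the program accepts if variable 0 finally holds a pair. *)
Definition input_store (t : tree) : store := update (fun _ => Nil) 0 t.

Definition accepting (sigma : store) : bool := is_pair (sigma 0).

(* The problem Q, on the instances satisfying the assumption P, is decidable in
   time polynomial in the size of the encoded instance. *)
Definition ptime_decidable (I : Type) (encode : I -> tree) (P Q : I -> Prop) :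
    Prop :=
  exists (c : cmd) (a k : nat),
    forall x : I, P x ->
      exists (n : nat) (tau : store),
        [/\ exec c (input_store (encode x)) n tau,
            n <= a * tree_size (encode x) ^ k + a
          & accepting tau <-> Q x].

Record instance : Type := Instance {
  states : finType;
  props : finType;
  system : transition_system states props;
  targets : {set states};
  cause : {set states};
  objective_of : objective;
  execution : seq states
}.

Definition encode_seq (ts : seq tree) : tree := foldr Cons Nil ts.

Definition encode_bool (b : bool) : tree := if b then Cons Nil Nil else Nil.

Definition encode_nat (n : nat) : tree := iter n (Cons Nil) Nil.

(* A predicate on a finite type is encoded by its bit vector. *)
Definition encode_pred (X : finType) (A : pred X) : tree :=
  encode_seq [seq encode_bool (A x) | x <- enum X].

(* A state is encoded by its index in unary; this is harmless, since the
   adjacency matrix already takes space quadratic in the number of states. *)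
Definition encode_state (S : finType) (s : S) : tree :=
  encode_nat (index s (enum S)).

Definition encode_objective (o : objective) : tree :=
  encode_bool (if o is Reachability then true else false).

(* Transitions are given by the adjacency matrix, labels by a bit matrix with
   rows indexed by states and columns by atomic propositions. *)
Definition encode_instance (x : instance) : tree :=
  let T := system x in
  encode_seq
    [:: encode_state (init T);
        encode_seq [seq encode_pred (trans T s) | s <- enum (states x)];
        encode_seq
          [seq encode_pred (fun p => p \in label T s) | s <- enum (states x)];
        encode_pred (fun s => s \in targets x);
        encode_pred (fun s => s \in cause x);
        encode_objective (objective_of x);
        encode_seq [seq encode_state s | s <- execution x]].

(* Main.v *)
(* Write n for the length of the execution pi and N for n plus the number of
   states. A finite maximal path that continues beyond the end of pi pays 1 for
   every further position, so cutting cycles there brings its length below N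
   without increasing its distance to pi. Distances can therefore be minimised
   by dynamic programming over the suffixes of pi, padded by one letter per
   state that matches no label. Paths start with a budget and pay for
   mismatches, so that only predecessors and maxima of unary numbers are needed.
   With K = N + 1, let the budget of a path ending in a terminal state outside E
   start at 2K, and give budget K to a walk that survives all positions. Such a
   walk is longer than the number of states, hence exists iff there is an
   infinite path avoiding C; since K exceeds every relevant distance, it is worth
   less than any finite path. Comparing the resulting value with the best
   remaining budget 2K - d of a path avoiding C and ending in E settles all cases:
   C is a cause iff the paths violating Phi are strictly better. Infinite paths
   never meet E, so they always count with the paths ending outside E.
   Polynomial time is established for functions between encoded data types, by
   closing the class of functions computed by WHILE programs under composition
   and under folds whose accumulator stays polynomially bounded. *)

Require Import Defs.
From mathcomp Require Import all_boot.
From mathcomp Require Import zify.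
(* The constructors Nil and Cons of tree are shadowed by mathcomp's seq. *)
Import Defs.

Set Implicit Arguments.
Unset Strict Implicit.
Unset Printing Implicit Defensive.

(** * Encodings of data types as trees and their sizes *)

Class encodable (X : Type) : Type := enc : X -> tree.

Instance encodable_unit : encodable unit := fun _ => Nil.
Instance encodable_bool : encodable bool := encode_bool.
Instance encodable_nat : encodable nat := encode_nat.
Instance encodable_prod (X Y : Type) {eX : encodable X} {eY : encodable Y} :
  encodable (X * Y) := fun p => Cons (enc p.1) (enc p.2).
(** A nonempty list has the same tree as the pair of its head and tail, and a number the same as a
    list of units, so passing between these views leaves the tree unchanged. *)
Instance encodable_seq (X : Type) {eX : encodable X} : encodable (seq X) :=
  fun s => encode_seq [seq enc x | x <- s].

Definition esize (X : Type) {eX : encodable X} (x : X) : nat :=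
  tree_size (enc x).

Lemma tree_size_gt0 t : 0 < tree_size t.
Proof. by case: t. Qed.

Lemma esize_gt0 (X : Type) {eX : encodable X} (x : X) : 0 < esize x.
Proof. exact: tree_size_gt0. Qed.

Lemma esize_pair (X Y : Type) {eX : encodable X} {eY : encodable Y}
  (x : X) (y : Y) : esize (x, y) = (esize x + esize y).+1.
Proof. by []. Qed.

Lemma esize_cons (X : Type) {eX : encodable X} (x : X) s :
  esize (x :: s) = (esize x + esize s).+1.
Proof. by []. Qed.

Lemma esize_nat n : esize n = n.*2.+1.
Proof. by elim: n => //= n IHn; rewrite /esize /= -/(esize n) IHn; lia. Qed.

Lemma esize_seq (X : Type) {eX : encodable X} (s : seq X) :
  esize s = (\sum_(x <- s) (esize x).+1).+1.
Proof.
by elim: s => [|x s IHs]; rewrite ?big_nil // big_cons esize_cons IHs; lia.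
Qed.

Lemma size_le_esize (X : Type) {eX : encodable X} (s : seq X) :
  size s <= esize s.
Proof. by elim: s => //= x s IHs; rewrite esize_cons; lia. Qed.

Lemma mem_esize (X : Type) {eX : encodable X} (s1 s2 : seq X) (x : X) :
  esize x <= esize (s1 ++ x :: s2).
Proof. by rewrite esize_seq big_cat big_cons /=; lia. Qed.

(** * Polynomially bounded functions *)

Definition pbounded (X : Type) {eX : encodable X} (f : X -> nat) : Prop :=
  exists e, forall x, f x <= (esize x).+1 ^ e.

Section Pbounded.
Context {X : Type} {eX : encodable X}.
Implicit Types f g : X -> nat.

Lemma pbounded_le f g : (forall x, f x <= g x) -> pbounded g -> pbounded f.
Proof. by move=> fg [e ge]; exists e => x; apply: leq_trans (ge x). Qed.

Lemma pbounded_const c : pbounded (fun _ : X => c).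
Proof.
exists c => x; case: c => // c; apply: leq_trans (ltnW (ltn_expl _ (ltnSn 1))) _.
by rewrite leq_exp2r // ltnS esize_gt0.
Qed.

Lemma pbounded_esize : pbounded (@esize X eX).
Proof. by exists 1 => x. Qed.

Lemma pbounded_add f g : pbounded f -> pbounded g ->
  pbounded (fun x => f x + g x).
Proof.
move=> [d fd] [e ge]; exists (d + e).+1 => x; rewrite expnS.
have b1 : 1 < (esize x).+1 by rewrite ltnS esize_gt0.
have le1 : (esize x).+1 ^ d <= (esize x).+1 ^ (d + e).
  by rewrite leq_exp2l // leq_addr.
have le2 : (esize x).+1 ^ e <= (esize x).+1 ^ (d + e).
  by rewrite leq_exp2l // leq_addl.
apply: leq_trans (leq_add (fd x) (ge x)) _.
by apply: leq_trans (leq_add le1 le2) _; rewrite addnn -mul2n leq_mul2r b1 orbT.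
Qed.

Lemma pbounded_mul f g : pbounded f -> pbounded g ->
  pbounded (fun x => f x * g x).
Proof.
by move=> [d fd] [e ge]; exists (d + e) => x; rewrite expnD leq_mul.
Qed.

Lemma pbounded_S f : pbounded f -> pbounded (fun x => (f x).+1).
Proof.
move=> pf; apply: pbounded_le (pbounded_add pf (pbounded_const 1)) => x.
by rewrite addn1.
Qed.

Lemma pbounded_exp f e : pbounded f -> pbounded (fun x => f x ^ e).
Proof.
move=> pf; elim: e => [|e IHe]; first exact: pbounded_const.
by apply: pbounded_le (pbounded_mul pf IHe) => x; rewrite expnS.
Qed.

Lemma pbounded_comp (Y : Type) (eY : encodable Y) (h : X -> Y) (g : Y -> nat) :
  pbounded (fun x => esize (h x)) -> pbounded g -> pbounded (fun x => g (h x)).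
Proof.
move=> ph [e ge]; apply: pbounded_le (pbounded_exp e (pbounded_S ph)) => x.
exact: ge.
Qed.

End Pbounded.

(** * Polynomial-time functions *)

(* Register k holds the input and then the output; the registers below k are
   left untouched, those above k are scratch space holding arbitrary values. *)
Definition computes (X Y : Type) {eX : encodable X} {eY : encodable Y} (k : nat)
    (c : cmd) (f : X -> Y) (T : X -> nat) : Prop :=
  forall sigma x, sigma k = enc x ->
  exists n tau, [/\ exec c sigma n tau, n <= T x, tau k = enc (f x)
                  & forall y, y < k -> tau y = sigma y].

(* The size of the output must be bounded separately: since cons shares its
   arguments, n steps may build a tree of size exponential in n. *)
Definition ptime (X Y : Type) {eX : encodable X} {eY : encodable Y}
    (f : X -> Y) : Prop :=
  pbounded (fun x => esize (f x)) /\
  forall k, exists c T, pbounded T /\ computes k c f T.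

Lemma update_eq sigma k t : update sigma k t k = t.
Proof. by rewrite /update eqxx. Qed.

Lemma update_neq sigma k t y : y != k -> update sigma k t y = sigma y.
Proof. by rewrite /update => /negPf ->. Qed.

(** A computation overwrites its input register, so it is run on a copy when the input is needed
    again. *)
Lemma computes_copy (X Y : Type) {eX : encodable X} {eY : encodable Y} k j c
    (f : X -> Y) (T : X -> nat) :
  computes j c f T -> k < j ->
  forall sigma x, sigma k = enc x ->
  exists n tau, [/\ exec (Seq (Assign j (EVar k)) c) sigma n tau, n <= 2 + T x,
                    tau j = enc (f x) & forall y, y < j -> tau y = sigma y].
Proof.
move=> cT kj sigma x sk.
have [|n [tau [ex le t fr]]] := cT (update sigma j (sigma k)) x.
  by rewrite update_eq.
exists (2 + n), tau; split=> //; last by move=> y yj; rewrite fr // update_neq // ltn_eqF.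
exact: ExecSeq (ExecAssign j (EVar k) sigma) ex.
Qed.

Section Ptime.
Context {X Y Z A : Type} {eX : encodable X} {eY : encodable Y}
  {eZ : encodable Z} {eA : encodable A}.

Lemma ptime_expr (f : X -> Y) (e : nat -> expr) :
  pbounded (fun x => esize (f x)) ->
  (forall sigma k x, sigma k = enc x -> eval sigma (e k) = enc (f x)) ->
  ptime f.
Proof.
move=> pf He; split=> // k.
exists (Assign k (e k)), (fun=> (expr_cost (e k)).+1).
split=> [|sigma x sk]; first exact: pbounded_const.
eexists; eexists; split; [exact: ExecAssign | by [] | |].
  by rewrite update_eq; apply: He.
by move=> y yk; rewrite update_neq // ltn_eqF.
Qed.

Lemma ptime_enc (f : X -> Y) : (forall x, enc (f x) = enc x) -> ptime f.
Proof.
move=> fE; apply: (ptime_expr (e := EVar)) => [|sigma k x /= ->]; last by rewrite fE.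
by apply: pbounded_le pbounded_esize => x; rewrite /esize fE.
Qed.

Lemma ptime_eq (f g : X -> Y) : f =1 g -> ptime f -> ptime g.
Proof.
move=> fg [pf cf]; split=> [|k].
  by apply: pbounded_le pf => x; rewrite fg.
have [c [T [pT cT]]] := cf k; exists c, T; split=> // sigma x /cT [n [tau]].
by rewrite fg => H; exists n, tau.
Qed.

Lemma ptime_comp (g : Y -> Z) (f : X -> Y) :
  ptime g -> ptime f -> ptime (fun x => g (f x)).
Proof.
move=> [pg cg] [pf cf]; split=> [|k]; first exact: pbounded_comp pf pg.
have [c [T [pT cT]]] := cf k; have [d [U [pU dU]]] := cg k.
exists (Seq c d), (fun x => T x + U (f x)); split.
  exact: pbounded_add (pbounded_comp pf pU).
move=> sigma x /cT [n1 [tau1 [ex1 le1 t1 fr1]]].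
have [n2 [tau2 [ex2 le2 t2 fr2]]] := dU _ _ t1.
exists (n1 + n2), tau2; split=> //; [exact: ExecSeq ex2 | exact: leq_add |].
by move=> y yk; rewrite fr2 // fr1.
Qed.

Lemma ptime_pair (f : X -> Y) (g : X -> Z) :
  ptime f -> ptime g -> ptime (fun x => (f x, g x)).
Proof.
move=> [pf cf] [pg cg]; split=> [|k].
  exact: pbounded_S (pbounded_add pf pg).
have [c [T [pT cT]]] := cf k.+1; have [d [U [pU dU]]] := cg k.+2.
exists (Seq (Seq (Assign k.+1 (EVar k)) c) (Seq (Seq (Assign k.+2 (EVar k)) d)
  (Assign k (ECons (EVar k.+1) (EVar k.+2))))), (fun x => T x + U x + 8); split.
  exact: pbounded_add (pbounded_add pT pU) (pbounded_const 8).
move=> sigma x sk.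
have [n1 [tau1 [ex1 le1 t1 fr1]]] := computes_copy cT (ltnSn k) sk.
have sk1 : tau1 k = enc x by rewrite fr1.
have [n2 [tau2 [ex2 le2 t2 fr2]]] := computes_copy dU (ltnW (ltnSn k.+1)) sk1.
exists (n1 + (n2 + 4)); eexists; split.
- exact: ExecSeq ex1 (ExecSeq ex2 (ExecAssign _ _ _)).
- lia.
- by rewrite update_eq /= t2 fr2 ?t1.
by move=> y yk; rewrite update_neq ?fr2 ?fr1 ?ltn_eqF //; lia.
Qed.

(** The tree of [l x], if nonempty, is already that of [(a, t)]: a single cons with the input
    prepares the argument of [g]. *)
Lemma ptime_case (l : X -> seq A) (f : X -> Y) (g : X -> A -> seq A -> Y) :
  ptime l -> ptime f ->
  ptime (fun p : X * (A * seq A) => g p.1 p.2.1 p.2.2) ->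
  ptime (fun x => if l x is a :: t then g x a t else f x).
Proof.
move=> [pl cl] [pf cf] [[e ge] cg]; split=> [|k].
  apply: (@pbounded_le _ _ _
    (fun x => esize (f x) + (esize x + @esize (seq A) _ (l x)).+2 ^ e)).
    move=> x; case E: (l x) => [|a t]; first by rewrite leq_addr.
    by apply: leq_trans (ge (x, (a, t))) _; rewrite leq_addl.
  apply: pbounded_add pf (pbounded_exp _ _); do 2!apply: pbounded_S.
  exact: pbounded_add pbounded_esize pl.
have [c [T [pT cT]]] := cl k.+1.
have [d1 [U1 [pU1 dU1]]] := cf k; have [d2 [U2 [[e' Ue] dU2]]] := cg k.
exists (Seq (Seq (Assign k.+1 (EVar k)) c) (If (EVar k.+1)
    (Seq (Assign k (ECons (EVar k) (EVar k.+1))) d2) d1)),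
  (fun x => T x + (U1 x + (esize x + @esize (seq A) _ (l x)).+2 ^ e') + 8); split.
  apply: pbounded_add (pbounded_const 8); apply: pbounded_add pT _.
  apply: pbounded_add pU1 (pbounded_exp _ _); do 2!apply: pbounded_S.
  exact: pbounded_add pbounded_esize pl.
move=> sigma x sk.
have [n1 [tau1 [ex1 le1 t1 fr1]]] := computes_copy cT (ltnSn k) sk.
have sk1 : tau1 k = enc x by rewrite fr1.
have fr y : y < k -> tau1 y = sigma y by move=> yk; rewrite fr1 //; lia.
case E: (l x) => [|a t].
  have [n2 [tau2 [ex2 le2 t2 fr2]]] := dU1 _ _ sk1.
  exists (n1 + (2 + n2)), tau2; split=> //; last by move=> y yk; rewrite fr2 ?fr.
    by apply: ExecSeq ex1 _; apply: ExecIf; rewrite /= t1 E.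
  by rewrite -E; lia.
have [|n2 [tau2 [ex2 le2 t2 fr2]]] :=
  dU2 (update tau1 k (Cons (tau1 k) (tau1 k.+1))) (x, (a, t)).
  by rewrite update_eq sk1 t1 E.
have le3 := leq_trans le2 (Ue _).
exists (n1 + (2 + (4 + n2))), tau2; split=> //.
- apply: ExecSeq ex1 _; apply: ExecIf; rewrite [eval _ _]/= t1 E.
  exact: ExecSeq (ExecAssign k (ECons (EVar k) (EVar k.+1)) tau1) ex2.
- move: le3; rewrite esize_pair (_ : esize (a, t) = esize (a :: t)) //; lia.
by move=> y yk; rewrite fr2 // update_neq ?fr // ltn_eqF.
Qed.

(** Register [k] holds [x], [k.+1] the rest of the list, [k.+2] the accumulator, [k.+3] the argument
    and result of the body. Each round costs 14 steps besides the body, and the last test costs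
    2. *)
Lemma exec_foldl k c (g : X * (Z * A) -> Z) T M (x : X) :
  computes k.+3 c g T ->
  forall (l : seq A) (z : Z) sigma,
  (forall l1 a l2, l = l1 ++ a :: l2 ->
     T (x, (foldl (fun z a => g (x, (z, a))) z l1, a)) <= M) ->
  sigma k = enc x -> sigma k.+1 = enc l -> sigma k.+2 = enc z ->
  exists n tau,
  [/\ exec (While (EVar k.+1)
        (Seq (Assign k.+3 (ECons (EVar k) (ECons (EVar k.+2) (EHd (EVar k.+1)))))
        (Seq c (Seq (Assign k.+2 (EVar k.+3))
                    (Assign k.+1 (ETl (EVar k.+1))))))) sigma n tau,
      n <= size l * (M + 14) + 2,
      tau k.+2 = enc (foldl (fun z a => g (x, (z, a))) z l)
    & forall y, y <= k -> tau y = sigma y].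
Proof.
move=> cT; elim=> [|a l IHl] z sigma HM sk sk1 sk2.
  exists 2, sigma; split=> //.
  by apply: (@ExecWhileStop (EVar k.+1)); rewrite /= sk1.
set s1 := update sigma k.+3 (Cons (enc x) (Cons (enc z) (enc a))).
have [|n1 [tau1 [ex1 le1 t1 fr1]]] := cT s1 (x, (z, a)).
- by rewrite /s1 update_eq.
set s2 := update (update tau1 k.+2 (tau1 k.+3)) k.+1 (enc l).
have fr : forall y, y < k.+3 -> tau1 y = sigma y.
  by move=> y yk; rewrite fr1 // /s1 update_neq // ltn_eqF.
have fr' : forall y, y <= k -> s2 y = sigma y.
  by move=> y yk; rewrite /s2 !update_neq ?fr //; lia.
have [||||n2 [tau2 [ex2 le2 t2 fr2]]] := IHl (g (x, (z, a))) s2.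
- by move=> l1 a' l2 e; apply: (HM (a :: l1) a' l2); rewrite e.
- by rewrite fr'.
- by rewrite /s2 update_eq.
- by rewrite /s2 update_neq ?update_eq ?t1 //; lia.
have leT := HM [::] a l erefl; rewrite /= in leT.
exists (2 + (7 + (n1 + (2 + 3))) + n2), tau2; split=> //.
- apply: ExecWhileLoop ex2; first by rewrite /= sk1.
  apply: (ExecSeq (sigma2 := s1)).
    have -> : s1 = update sigma k.+3
        (eval sigma (ECons (EVar k) (ECons (EVar k.+2) (EHd (EVar k.+1))))).
      by rewrite /s1 /= sk sk1 sk2.
    exact: ExecAssign.
  apply: ExecSeq ex1 _; apply: ExecSeq (ExecAssign _ _ _) _.
  have -> : s2 = update (update tau1 k.+2 (tau1 k.+3)) k.+1
      (eval (update tau1 k.+2 (tau1 k.+3)) (ETl (EVar k.+1))).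
    by rewrite /s2 /= update_neq ?(fr k.+1) ?sk1 //; lia.
  exact: ExecAssign.
- by rewrite /= mulSn; lia.
by move=> y yk; rewrite fr2 // fr'.
Qed.

(** The bound [S] concerns all intermediate accumulators: iterating a polynomial-time step could
    otherwise double the size each time. *)
Lemma ptime_foldl (l : X -> seq A) (i : X -> Z) (g : X -> Z -> A -> Z) S :
  ptime l -> ptime i -> ptime (fun p : X * (Z * A) => g p.1 p.2.1 p.2.2) -> pbounded S ->
  (forall x l1 l2, l x = l1 ++ l2 ->
     esize (foldl (g x) (i x) l1) <= S x) ->
  ptime (fun x => foldl (g x) (i x) (l x)).
Proof.
move=> [pl cl] [pi ci] [pg cg] pS bS; split=> [|k].
  by apply: pbounded_le pS => x; apply: (bS x (l x) [::]); rewrite cats0.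
have [c1 [T1 [pT1 cT1]]] := cl k.+1; have [c2 [T2 [pT2 cT2]]] := ci k.+2.
have [c [T [[e Te] cT]]] := cg k.+3.
(* The size of [(x, (z, a))] exceeds the sum of the sizes of its parts by 2, and the base used in
   [pbounded] adds 1 more. *)
pose M x := (@esize X eX x + (S x + @esize _ (@encodable_seq A eA) (l x)) + 3) ^ e.
exists (Seq (Seq (Assign k.+1 (EVar k)) c1) (Seq (Seq (Assign k.+2 (EVar k)) c2)
  (Seq (While (EVar k.+1)
        (Seq (Assign k.+3 (ECons (EVar k) (ECons (EVar k.+2) (EHd (EVar k.+1)))))
        (Seq c (Seq (Assign k.+2 (EVar k.+3))
                    (Assign k.+1 (ETl (EVar k.+1)))))))
    (Assign k (EVar k.+2))))),
  (fun x => T1 x + T2 x + esize (l x) * (M x + 14) + 8); split.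
  apply: pbounded_add (pbounded_const 8).
  apply: pbounded_add (pbounded_add pT1 pT2) _; apply: (pbounded_mul pl).
  apply: pbounded_add (pbounded_const 14); apply: pbounded_exp.
  apply: pbounded_add (pbounded_const 3).
  exact: pbounded_add pbounded_esize (pbounded_add pS pl).
move=> sigma x sk.
have [n1 [tau1 [ex1 le1 t1 fr1]]] := computes_copy cT1 (ltnSn k) sk.
have sk1 : tau1 k = enc x by rewrite fr1.
have [n2 [tau2 [ex2 le2 t2 fr2]]] := computes_copy cT2 (ltnW (ltnSn k.+1)) sk1.
have bM l1 a l2 : l x = l1 ++ a :: l2 ->
    T (x, (foldl (g x) (i x) l1, a)) <= M x.
  move=> e1; apply: leq_trans (Te _) _.
  rewrite !esize_pair; case: (posnP e) => [e0|e_gt0].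
    by rewrite /M e0 !expn0.
  rewrite /M leq_exp2r //.
  by have := bS _ _ _ e1; have := @mem_esize A eA l1 l2 a; rewrite -e1; lia.
have [|||n3 [tau3 [ex3 le3 t3 fr3]]] := exec_foldl (sigma := tau2) cT bM.
- by rewrite fr2.
- by rewrite fr2.
- by [].
have leM : size (l x) * (M x + 14) <= esize (l x) * (M x + 14).
  by rewrite leq_mul2r size_le_esize orbT.
exists (n1 + (n2 + (n3 + 2))); eexists; split.
- exact: ExecSeq ex1 (ExecSeq ex2 (ExecSeq ex3 (ExecAssign _ _ _))).
- lia.
- by rewrite update_eq /= t3.
by move=> y yk; rewrite update_neq ?fr3 ?fr2 ?fr1 ?ltn_eqF //; lia.
Qed.

End Ptime.

(** * A library of polynomial-time functions *)

Lemma ptime_id (X : Type) (eX : encodable X) : ptime (fun x : X => x).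
Proof. exact: ptime_enc. Qed.

Fixpoint quote (t : tree) : expr :=
  if t is Cons a b then ECons (quote a) (quote b) else ENil.

Lemma eval_quote sigma t : eval sigma (quote t) = t.
Proof. by elim: t => //= a -> b ->. Qed.

Section Recoding.
Context {X Y Z A B : Type} {eX : encodable X} {eY : encodable Y}
  {eZ : encodable Z} {eA : encodable A} {eB : encodable B}.

Lemma ptime_const (y : Y) : ptime (fun _ : X => y).
Proof.
apply: (ptime_expr (e := fun=> quote (enc y))); first exact: pbounded_const.
by move=> *; rewrite eval_quote.
Qed.

Lemma ptime_recode (g : Y -> Z) (f : X -> Y) :
  (forall y, enc (g y) = enc y) -> ptime f -> ptime (fun x => g (f x)).
Proof. by move=> gE; apply: ptime_comp; apply: ptime_enc. Qed.

Lemma tree_size_hd t : tree_size (tree_hd t) <= tree_size t.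
Proof. by case: t => //= *; lia. Qed.

Lemma tree_size_tl t : tree_size (tree_tl t) <= tree_size t.
Proof. by case: t => //= *; lia. Qed.

Lemma ptime_hd (g : Y -> Z) (f : X -> Y) :
  (forall y, enc (g y) = tree_hd (enc y)) -> ptime f -> ptime (fun x => g (f x)).
Proof.
move=> gE; apply: ptime_comp; apply: (ptime_expr (e := fun k => EHd (EVar k))).
  by apply: pbounded_le pbounded_esize => y; rewrite /esize gE tree_size_hd.
by move=> sigma k x /= ->; rewrite gE.
Qed.

Lemma ptime_tl (g : Y -> Z) (f : X -> Y) :
  (forall y, enc (g y) = tree_tl (enc y)) -> ptime f -> ptime (fun x => g (f x)).
Proof.
move=> gE; apply: ptime_comp; apply: (ptime_expr (e := fun k => ETl (EVar k))).
  by apply: pbounded_le pbounded_esize => y; rewrite /esize gE tree_size_tl.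
by move=> sigma k x /= ->; rewrite gE.
Qed.

End Recoding.

Section Constructors.
Context {X Y Z A B : Type} {eX : encodable X} {eY : encodable Y}
  {eZ : encodable Z} {eA : encodable A} {eB : encodable B}.

Lemma ptime_fst (f : X -> Y * Z) : ptime f -> ptime (fun x => (f x).1).
Proof. exact: ptime_hd. Qed.

Lemma ptime_snd (f : X -> Y * Z) : ptime f -> ptime (fun x => (f x).2).
Proof. exact: ptime_tl. Qed.

Lemma ptime_behead (f : X -> seq A) : ptime f -> ptime (fun x => behead (f x)).
Proof. by apply: ptime_tl; case. Qed.

Lemma ptime_predn (f : X -> nat) : ptime f -> ptime (fun x => (f x).-1).
Proof. by apply: ptime_tl; case. Qed.

Lemma ptime_cons (f : X -> A) (g : X -> seq A) :
  ptime f -> ptime g -> ptime (fun x => f x :: g x).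
Proof.
move=> pf pg; apply: (ptime_recode (g := fun p => p.1 :: p.2)) (ptime_pair pf pg).
by case.
Qed.

Lemma ptime_succn (f : X -> nat) : ptime f -> ptime (fun x => (f x).+1).
Proof.
move=> pf; apply: (ptime_recode (g := fun p => p.2.+1)) (ptime_pair (ptime_const tt) pf).
by case; case.
Qed.

(** With this recoding, iterating [n] times is a fold over a list of length [n]. *)
Lemma enc_nseq n : enc (nseq n tt) = enc n.
Proof. by elim: n => // n IHn; rewrite /= /enc /= -[RHS]/(Cons Nil (enc n)) -IHn. Qed.

Lemma ptime_nseq (f : X -> nat) : ptime f -> ptime (fun x => nseq (f x) tt).
Proof. exact: (ptime_recode enc_nseq). Qed.

End Constructors.

(** * Conditionals and folds with bounded growth *)

Section Branching.
Context {X Y Z A B : Type} {eX : encodable X} {eY : encodable Y}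
  {eZ : encodable Z} {eA : encodable A} {eB : encodable B}.

Lemma ptime_if (b : X -> bool) (f g : X -> Y) :
  ptime b -> ptime f -> ptime g -> ptime (fun x => if b x then f x else g x).
Proof.
move=> pb pf pg.
(* [true] and [[:: tt]] have the same tree, as have [false] and [[::]]. *)
have pl : ptime (fun x => nseq (b x) tt).
  by apply: (ptime_recode (g := fun b : bool => nseq b tt)) pb; case.
apply: (ptime_eq (f := fun x => if nseq (b x) tt is _ :: _ then f x else g x)).
  by move=> x; case: (b x).
apply: (ptime_case (g := fun x _ _ => f x)) => //.
by apply: (ptime_comp pf); apply: ptime_fst; exact: ptime_id.
Qed.

Lemma ptime_head (d : A) (l : X -> seq A) :
  ptime l -> ptime (fun x => head d (l x)).
Proof.
move=> pl; apply: (ptime_case (f := fun=> d) (g := fun _ a _ => a)) => //.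
  exact: ptime_const.
by do 2?[apply: ptime_fst | apply: ptime_snd]; exact: ptime_id.
Qed.

Lemma ptime_posn (f : X -> nat) : ptime f -> ptime (fun x => 0 < f x).
Proof.
move=> pf; apply: (ptime_eq (f := fun x => if nseq (f x) tt is _ :: _ then true else false)).
  by move=> x; case: (f x).
by apply: (ptime_case (g := fun _ _ _ => true)) (ptime_nseq pf) _ _; apply: ptime_const.
Qed.

Lemma esize_foldl (g : Z -> A -> Z) z l M :
  (forall z l1 a l2, l = l1 ++ a :: l2 -> esize (g z a) <= esize z + M) ->
  esize (foldl g z l) <= esize z + size l * M.
Proof.
elim: l z => [|a l IHl] z HM /=; first by rewrite addn0.
apply: leq_trans (IHl _ _) _ => [y l1 b l2 lE|].
  by apply: (HM y (a :: l1) b l2); rewrite lE.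
by have := HM z [::] a l erefl; rewrite mulSn; lia.
Qed.

(** Growth that depends only on [x] and the current element adds up along the list, so the
    accumulator stays polynomial. *)
Lemma ptime_foldl_add (l : X -> seq A) (i : X -> Z) (g : X -> Z -> A -> Z) D :
  ptime l -> ptime i -> ptime (fun p : X * (Z * A) => g p.1 p.2.1 p.2.2) ->
  pbounded D -> (forall x z a, esize (g x z a) <= esize z + D (x, a)) ->
  ptime (fun x => foldl (g x) (i x) (l x)).
Proof.
move=> pl pi pg [e De] bg.
apply: (ptime_foldl (S := fun x => esize (i x) + @esize _ (@encodable_seq A eA) (l x) *
  (esize x + @esize _ (@encodable_seq A eA) (l x)).+2 ^ e)) => //.
  apply: pbounded_add pi.1 (pbounded_mul pl.1 (pbounded_exp _ _)).
  do 2!apply: pbounded_S; exact: pbounded_add pbounded_esize pl.1.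
move=> x l1 l2 lE; apply: leq_trans (esize_foldl (M := (esize x + esize (l x)).+2 ^ e) _ _) _.
  move=> z l3 a l4 l1E; apply: leq_trans (bg x z a) _; rewrite leq_add2l.
  apply: leq_trans (De _) _; case: (posnP e) => [->//|e_gt0]; rewrite leq_exp2r // esize_pair.
  by have := @mem_esize A eA l3 (l4 ++ l2) a; rewrite lE l1E -catA /=; lia.
rewrite leq_add2l leq_mul2r; apply/orP; right.
apply: (@leq_trans (size (l x))); last exact: size_le_esize.
by rewrite lE size_cat leq_addr.
Qed.

End Branching.

(** * Automation for constructors and projections *)

Ltac ptime_step :=
  match goal with
  | H : ptime ?f |- ptime ?f => exact H
  | |- ptime (fun x => x) => exact: ptime_id
  | |- ptime (fun _ => ?y) => exact: ptime_const
  | |- ptime fst => exact: (ptime_fst (ptime_id _))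
  | |- ptime snd => exact: (ptime_snd (ptime_id _))
  | |- ptime (fun x => (@?f x).1) => apply: (@ptime_fst _ _ _ _ _ _ f)
  | |- ptime (fun x => (@?f x).2) => apply: (@ptime_snd _ _ _ _ _ _ f)
  | |- ptime (fun x => (@?f x, @?g x)) => apply: (@ptime_pair _ _ _ _ _ _ f g)
  | |- ptime (fun x => @?f x :: @?g x) => apply: (@ptime_cons _ _ _ _ f g)
  | |- ptime (fun x => behead (@?f x)) => apply: (@ptime_behead _ _ _ _ f)
  | |- ptime (fun x => (@?f x).-1) => apply: (@ptime_predn _ _ f)
  | |- ptime (fun x => (@?f x).+1) => apply: (@ptime_succn _ _ f)
  | |- ptime (fun x => nseq (@?f x) tt) => apply: (@ptime_nseq _ _ f)
  end.
Ltac ptime := repeat ptime_step.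

(** * Unary arithmetic and basic list operations *)

Section Arithmetic.
Context {X A : Type} {eX : encodable X} {eA : encodable A}.

Lemma ptime_negb (f : X -> bool) : ptime f -> ptime (fun x => ~~ f x).
Proof. by move=> pf; apply: ptime_if; ptime. Qed.

Lemma ptime_andb (f g : X -> bool) :
  ptime f -> ptime g -> ptime (fun x => f x && g x).
Proof. by move=> pf pg; apply: ptime_if; ptime. Qed.

Lemma ptime_eqb (f g : X -> bool) :
  ptime f -> ptime g -> ptime (fun x => f x == g x).
Proof.
move=> pf pg; apply: (ptime_eq (f := fun x => if f x then g x else ~~ g x)).
  by move=> x; case: (f x); case: (g x).
by apply: ptime_if => //; apply: ptime_negb.
Qed.

Lemma ptime_subn (f g : X -> nat) :
  ptime f -> ptime g -> ptime (fun x => f x - g x).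
Proof.
move=> pf pg.
apply: (ptime_eq (f := fun x => foldl (fun z _ => z.-1) (f x) (nseq (g x) tt))).
  move=> x; elim: (g x) (f x) => [|n IHn] m /=; first by rewrite subn0.
  by rewrite IHn; lia.
apply: (ptime_foldl_add (D := fun=> 0)); [by ptime | by [] | by ptime | exact: pbounded_const |].
by move=> x z _; rewrite !esize_nat; lia.
Qed.

Lemma ptime_ltn (f g : X -> nat) :
  ptime f -> ptime g -> ptime (fun x => f x < g x).
Proof.
move=> pf pg; apply: (ptime_eq (f := fun x => 0 < g x - f x)).
  by move=> x; rewrite subn_gt0.
by apply: ptime_posn; apply: ptime_subn.
Qed.

Lemma ptime_maxn (f g : X -> nat) :
  ptime f -> ptime g -> ptime (fun x => maxn (f x) (g x)).
Proof. by move=> pf pg; apply: ptime_if => //; apply: ptime_ltn. Qed.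

Lemma ptime_addn (f g : X -> nat) :
  ptime f -> ptime g -> ptime (fun x => f x + g x).
Proof.
move=> pf pg.
apply: (ptime_eq (f := fun x => foldl (fun z _ => z.+1) (f x) (nseq (g x) tt))).
  move=> x; elim: (g x) (f x) => [|n IHn] m /=; first by rewrite addn0.
  by rewrite IHn; lia.
(* A successor adds one [Cons] and one [Nil], hence 2 nodes. *)
apply: (ptime_foldl_add (D := fun=> 2)); [by ptime | by [] | by ptime | exact: pbounded_const |].
by move=> x z _; rewrite !esize_nat; lia.
Qed.

Lemma ptime_size (l : X -> seq A) : ptime l -> ptime (fun x => size (l x)).
Proof.
move=> pl; apply: (ptime_eq (f := fun x => foldl (fun z _ => z.+1) 0 (l x))).
  move=> x; rewrite -[RHS]add0n; elim: (l x) 0 => [|a s IHs] m /=; first by rewrite addn0.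
  by rewrite IHs; lia.
apply: (ptime_foldl_add (D := fun=> 2)); [by [] | by ptime | by ptime | exact: pbounded_const |].
by move=> x z _; rewrite !esize_nat; lia.
Qed.

Lemma ptime_nth (d : A) (l : X -> seq A) (i : X -> nat) :
  ptime l -> ptime i -> ptime (fun x => nth d (l x) (i x)).
Proof.
move=> pl pi; apply: (ptime_eq (f := fun x =>
    head d (foldl (fun z _ => behead z) (l x) (nseq (i x) tt)))).
  move=> x; elim: (i x) (l x) => [|n IHn] s /=; first by rewrite nth0.
  by rewrite IHn nth_behead.
apply: ptime_head; apply: (ptime_foldl_add (D := fun=> 0));
  [by ptime | by [] | by ptime | exact: pbounded_const |].
by move=> x z _; rewrite addn0; case: z => //= a z; rewrite esize_cons; lia.
Qed.

Lemma foldl_cons (T : Type) (s t : seq T) :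
  foldl (fun z a => a :: z) t s = catrev s t.
Proof. by elim: s t => //= a s IHs t; rewrite IHs. Qed.

Lemma ptime_catrev (l m : X -> seq A) :
  ptime l -> ptime m -> ptime (fun x => catrev (l x) (m x)).
Proof.
move=> pl pm; apply: (ptime_eq (f := fun x => foldl (fun z a => a :: z) (m x) (l x))).
  by move=> x; rewrite foldl_cons.
apply: (ptime_foldl_add (D := fun p => (esize p).+1)) => //; first by ptime.
  by apply: pbounded_S; exact: pbounded_esize.
by move=> x z a; rewrite esize_cons esize_pair; lia.
Qed.

Lemma ptime_rev (l : X -> seq A) : ptime l -> ptime (fun x => rev (l x)).
Proof. by move=> pl; apply: ptime_catrev => //; ptime. Qed.

End Arithmetic.

(** * Maps, zips and tests on lists *)

Section Sequences.
Context {X A B : Type} {eX : encodable X} {eA : encodable A} {eB : encodable B}.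

Lemma ptime_cat (l m : X -> seq A) :
  ptime l -> ptime m -> ptime (fun x => l x ++ m x).
Proof.
move=> pl pm; apply: (ptime_eq (f := fun x => catrev (rev (l x)) (m x))).
  by move=> x; rewrite catrevE revK.
by apply: ptime_catrev => //; apply: ptime_rev.
Qed.

Lemma ptime_map (h : X -> A -> B) (l : X -> seq A) :
  ptime (fun p : X * A => h p.1 p.2) -> ptime l ->
  ptime (fun x => map (h x) (l x)).
Proof.
move=> ph pl.
apply: (ptime_eq (f := fun x => rev (foldl (fun z a => h x a :: z) [::] (l x)))).
  move=> x; rewrite -[RHS]revK; congr rev; rewrite /rev.
  by elim: (l x) [::] => //= a s IHs t; rewrite IHs.
apply: ptime_rev.
apply: (ptime_foldl_add (D := fun p => (esize (h p.1 p.2)).+1)) => //.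
- exact: ptime_const.
- apply: ptime_cons; last by ptime.
  apply: (ptime_comp ph (f := fun p : X * (seq B * A) => (p.1, p.2.2))); ptime.
- by apply: pbounded_S; exact: ph.1.
by move=> x z a; rewrite esize_cons /=; lia.
Qed.

Lemma ptime_zip (l : X -> seq A) (m : X -> seq B) :
  ptime l -> ptime m -> ptime (fun x => zip (l x) (m x)).
Proof.
move=> pl pm.
(* The first component collects the pairs in reverse, the second is the unread part of [m x]. Since
   [b] is moved and not copied, a step adds only the size of [a] plus 1. *)
pose step (z : seq (A * B) * seq B) a :=
  if z.2 is b :: t then ((a, b) :: z.1, t) else z.
apply: (ptime_eq (f := fun x => rev (foldl step ([::], m x) (l x)).1)).
  move=> x; rewrite -[RHS]revK; congr rev; rewrite /rev.
  elim: (l x) (m x) [::] => [|a s IHs] [|b t] z //=; last exact: IHs.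
  by elim: s {IHs} => //= s; case.
apply: ptime_rev; apply: ptime_fst.
apply: (ptime_foldl_add (D := fun p => (esize p).+1)) => //.
- by ptime.
- apply: (ptime_case (l := fun p : X * ((seq (A * B) * seq B) * A) => p.2.1.2)
    (g := fun p b t => ((p.2.2, b) :: p.2.1.1, t))); ptime.
- by apply: pbounded_S; exact: pbounded_esize.
move=> x [z [|b t]] a; rewrite /step /= ?leq_addr //.
by rewrite !esize_pair !esize_cons !esize_pair; lia.
Qed.

Lemma esize_bool (b : bool) : esize b <= 3.
Proof. by case: b. Qed.

Lemma ptime_all (h : X -> A -> bool) (l : X -> seq A) :
  ptime (fun p : X * A => h p.1 p.2) -> ptime l ->
  ptime (fun x => all (h x) (l x)).
Proof.
move=> ph pl; apply: (ptime_eq (f := fun x => foldl (fun z a => z && h x a) true (l x))).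
  move=> x; rewrite -[RHS]andTb; elim: (l x) true => [|a s IHs] b /=; first by rewrite andbT.
  by rewrite IHs andbA.
apply: (ptime_foldl_add (D := fun=> 3)) => //.
- by ptime.
- apply: ptime_andb; first by ptime.
  apply: (ptime_comp ph (f := fun p : X * (bool * A) => (p.1, p.2.2))); ptime.
- exact: pbounded_const.
by move=> x z a; rewrite (leq_trans (esize_bool _)) // leq_addl.
Qed.

End Sequences.

(** * The shortest-path algorithm on bit matrices *)

Definition max_entry (bits : seq bool) (row : seq nat) : nat :=
  foldl (fun z p => if p.1 then maxn z p.2 else z) 0 (zip bits row).

Definition eq_bits (r s : seq bool) : bool :=
  all (fun p => p.1 == p.2) (zip r s).

(* Successors, label, membership in the cause, membership in the target set. *)
Definition state_data : Type := seq bool * (seq bool * (bool * bool)).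

(* The label of a position of the given execution, or padding after its end:
   padding does not match any label. *)
Definition word_letter : Type := bool * seq bool.

Definition dp_entry (a : word_letter) (z : nat * seq nat) (r : state_data) : nat :=
  if r.2.2.1 then 0 else
  let m := maxn (if r.2.2.2 then z.1 else 0) (max_entry r.1 z.2) in
  if a.1 && eq_bits a.2 r.2.1 then m else m.-1.

(** The first component is the budget for stopping at the current position. Going backwards, it
    drops at each letter of the execution, because a path stopping before that letter misses it;
    stopping before padding costs nothing. *)
Definition dp_step (data : seq state_data) (z : nat * seq nat) (a : word_letter) :
    nat * seq nat :=
  (if a.1 then z.1.-1 else z.1, map (dp_entry a z) data).

Definition dp (data : seq state_data) (b k0 : nat) (w : seq word_letter) :
    nat * seq nat :=
  foldl (dp_step data) (b, map (fun=> k0) data) w.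

(** * Polynomial time of the components of the algorithm *)

Section Algorithm.
Context {X : Type} {eX : encodable X}.

Lemma ptime_max_entry (f : X -> seq bool) (g : X -> seq nat) :
  ptime f -> ptime g -> ptime (fun x => max_entry (f x) (g x)).
Proof.
move=> pf pg; apply: (ptime_foldl_add (D := @esize _ _)).
- exact: ptime_zip.
- by ptime.
- by apply: ptime_if; ptime; apply: ptime_maxn; ptime.
- exact: pbounded_esize.
move=> x z [b n]; rewrite !esize_pair /=.
by case: b; rewrite !esize_nat; lia.
Qed.

Lemma ptime_eq_bits (f g : X -> seq bool) :
  ptime f -> ptime g -> ptime (fun x => eq_bits (f x) (g x)).
Proof.
move=> pf pg; apply: (ptime_all (h := fun _ p => p.1 == p.2)); last exact: ptime_zip.
by apply: ptime_eqb; ptime.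
Qed.

End Algorithm.

Lemma ptime_dp_entry :
  ptime (fun p : (word_letter * (nat * seq nat)) * state_data =>
           dp_entry p.1.1 p.1.2 p.2).
Proof.
have pm : ptime (fun p : (word_letter * (nat * seq nat)) * state_data =>
    maxn (if p.2.2.2.2 then p.1.2.1 else 0) (max_entry p.2.1 p.1.2.2)).
  apply: ptime_maxn; first by apply: ptime_if; ptime.
  by apply: ptime_max_entry; ptime.
apply: ptime_if; [by ptime|by ptime|apply: ptime_if; [|by []|by apply: ptime_predn]].
by apply: ptime_andb; ptime; apply: ptime_eq_bits; ptime.
Qed.

Lemma max_entry_le bits row : max_entry bits row <= \max_(n <- row) n.
Proof.
suff H m : foldl (fun z p => if p.1 then maxn z p.2 else z) m (zip bits row) <=
    maxn m (\max_(n <- row) n) by rewrite -[leqRHS]max0n; apply: H.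
elim: bits row m => [|b bits IH] [|n row] m /=; rewrite ?leq_maxl // big_cons.
by apply: leq_trans (IH _ _) _; case: b => /=; lia.
Qed.

(** Budgets only pass through maxima and predecessors, so they never exceed the initial ones. *)
Lemma dp_bound data b k0 w :
  let z := dp data b k0 w in
  [/\ z.1 <= b, size z.2 = size data & \max_(n <- z.2) n <= b + k0].
Proof.
elim/last_ind: w => [|w a].
  rewrite /dp /= size_map; split=> //; elim: data => [|r data IH]; rewrite ?big_nil //=.
  by rewrite big_cons geq_max IH leq_addl.
rewrite /dp foldl_rcons -/(dp _ _ _ _) /=; case: (dp _ _ _ _) => m row /= [mb rE le].
rewrite size_map; split=> //; first by case: ifP => _; lia.
elim: data {rE} => [|r data IH]; rewrite /= ?big_nil // big_cons geq_max IH andbT.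
have := max_entry_le r.1 row; rewrite /dp_entry /=.
by do 3!case: ifP => _ //; lia.
Qed.

Lemma ptime_dp (X : Type) {eX : encodable X} (data : X -> seq state_data)
    (b k0 : X -> nat) (w : X -> seq word_letter) :
  ptime data -> ptime b -> ptime k0 -> ptime w ->
  ptime (fun x => dp (data x) (b x) (k0 x) (w x)).
Proof.
move=> pd pb pk pw; rewrite /dp.
(* A step may copy one large entry to every state, so growth is not additive; the explicit bound of
   [dp_bound] is used instead. *)
refine (@ptime_foldl _ _ _ _ _ _ w (fun x => (b x, map (fun=> k0 x) (data x)))
  (fun x => dp_step (data x)) (fun x => (esize (b x) +
   esize (data x) * (esize (b x) + esize (k0 x)).+1).+2) pw _ _ _ _).
- apply: ptime_pair => //; apply: (ptime_map (h := fun x _ => k0 x)) => //.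
  by apply: (ptime_comp pk); ptime.
- apply: ptime_pair; first by apply: ptime_if; ptime.
  apply: (ptime_map (X := X * ((nat * seq nat) * word_letter))
    (h := fun p r => dp_entry p.2.2 p.2.1 r) (l := fun p => data p.1)).
    apply: (ptime_comp ptime_dp_entry
      (f := fun p : (X * ((nat * seq nat) * word_letter)) * state_data =>
              ((p.1.2.2, p.1.2.1), p.2))).
    by ptime.
  by apply: (ptime_comp pd); ptime.
- do 2!apply: pbounded_S; apply: pbounded_add pb.1 (pbounded_mul pd.1 _).
  by apply: pbounded_S; apply: pbounded_add pb.1 pk.1.
move=> x w1 w2 _; rewrite -/(dp _ _ _ _).
have := dp_bound (data x) (b x) (k0 x) w1; case: (dp _ _ _ _) => m row /= [mb rE le].
rewrite esize_pair.
have : esize row <= (size row * (esize (b x) + esize (k0 x)).+1).+1.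
  move: le; rewrite !esize_nat {rE}; elim: row => [|n row IH] //=.
  by rewrite big_cons geq_max esize_cons esize_nat => /andP [? /IH]; lia.
rewrite [esize m]esize_nat [esize (b x)]esize_nat => row_le.
apply: (@leq_trans ((b x).*2.+3 + size row * ((b x).*2.+1 + esize (k0 x)).+1)); first lia.
by rewrite !addSn !ltnS leq_add2l leq_mul2r rE size_le_esize orbT.
Qed.

(* Initial state, adjacency matrix, labels, targets, cause, objective and
   execution, laid out as in encode_instance. *)
Definition raw_instance : Type :=
  nat * (seq (seq bool) * (seq (seq bool) * (seq bool * (seq bool *
  (bool * (seq nat * unit)))))).

Section Decide.
Variable r : raw_instance.
Let adj := r.2.1.
Let lab := r.2.2.1.
Let targ := r.2.2.2.1.
Let cau := r.2.2.2.2.1.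
Let ex := r.2.2.2.2.2.2.1.

Definition raw_bound : nat := (size adj + size ex).+1.

Definition raw_data (goal : seq bool) : seq state_data :=
  zip adj (zip lab (zip cau goal)).

(** Listed in the order of processing: the padding, then the execution backwards. *)
Definition raw_word : seq word_letter :=
  map (fun=> (false, [::])) adj ++ rev (map (fun i => (true, nth [::] lab i)) ex).

Definition raw_others : seq bool :=
  map (fun p => ~~ p.2 && all negb p.1) (zip adj targ).

Definition raw_value (goal : seq bool) (k0 : nat) : nat :=
  nth 0 (dp (raw_data goal) (raw_bound + raw_bound) k0 raw_word).2 r.1.

Definition decide : bool :=
  if r.2.2.2.2.2.1 then raw_value targ 0 < raw_value raw_others raw_bound
  else raw_value raw_others raw_bound < raw_value targ 0.

End Decide.

Lemma ptime_raw_value (f : raw_instance -> seq bool) (k : raw_instance -> nat) :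
  ptime f -> ptime k -> ptime (fun r => raw_value r (f r) (k r)).
Proof.
move=> pf pk.
have pB : ptime (fun r => raw_bound r).
  by rewrite /raw_bound; ptime; apply: ptime_addn; apply: ptime_size; ptime.
apply: ptime_nth; last by ptime.
apply: ptime_snd; apply: ptime_dp => //.
- by do 3!(apply: ptime_zip; ptime).
- exact: ptime_addn.
apply: ptime_cat; first by apply: (ptime_map (h := fun _ _ => (false, [::]))); ptime.
apply: ptime_rev.
apply: (ptime_map (h := fun (r : raw_instance) i => (true, nth [::] r.2.2.1 i))); ptime.
by apply: ptime_nth; ptime.
Qed.

Lemma ptime_decide : ptime decide.
Proof.
have pB : ptime (fun r => raw_bound r).
  by rewrite /raw_bound; ptime; apply: ptime_addn; apply: ptime_size; ptime.
have pO : ptime (fun r => raw_others r).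
  apply: (ptime_map (h := fun (r : raw_instance) (p : seq bool * bool) => ~~ p.2 && all negb p.1)).
    apply: ptime_andb; first by apply: ptime_negb; ptime.
    by apply: (ptime_all (h := fun _ b => ~~ b)); [apply: ptime_negb|]; ptime.
  by apply: ptime_zip; ptime.
by apply: ptime_if; [by ptime|apply: ptime_ltn|apply: ptime_ltn];
  apply: ptime_raw_value => //; ptime.
Qed.

(** * Generalized Hamming distance and budgets *)

Lemma gen_hamming_nil (L : eqType) (v : seq L) : gen_hamming [::] v = size v.
Proof. by rewrite /gen_hamming /= /hamming take0 subn0. Qed.

Lemma gen_hamming_nilr (L : eqType) (w : seq L) : gen_hamming w [::] = size w.
Proof.
by case: w.
Qed.

(** With the two boundary cases, this makes the distance recursive letter by letter, as [value]
    is. *)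
Lemma gen_hamming_cons (L : eqType) (a b : L) (w v : seq L) :
  gen_hamming (a :: w) (b :: v) = (a != b) + gen_hamming w v.
Proof.
by rewrite /gen_hamming /= ltnS; case: ifP => _; rewrite /hamming /= subSS addnA.
Qed.

Lemma gen_hamming_le (L : eqType) (w v : seq L) :
  gen_hamming w v <= maxn (size w) (size v).
Proof.
elim: w v => [|a w IHw] [|b v]; rewrite ?gen_hamming_nil ?gen_hamming_nilr ?maxn0 //.
by rewrite gen_hamming_cons /=; have := IHw v; case: eqP => _ /=; lia.
Qed.

Section Budget.
Variables (S : finType) (L : eqType) (e : rel S) (C : {set S}) (lab : S -> L).
Implicit Types (w : seq L) (s t : S) (p : seq S).

Definition avoids s p : bool := path e s p && all [predC C] (s :: p).

(** The state reached at the end is unconstrained, just as [padding_value] starts from [K0] at every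
    state. *)
Fixpoint walk n s : bool :=
  if n is n'.+1 then (s \notin C) && [exists t, e s t && walk n' t] else true.

Lemma avoids_cons s t p :
  avoids s (t :: p) = [&& s \notin C, e s t & avoids t p].
Proof.
rewrite /avoids /=; case: (e s t); rewrite ?andbF //=.
by case: (path e t p); rewrite ?andbF.
Qed.

Lemma avoids_notin s p : avoids s p -> s \notin C.
Proof. by case/and3P. Qed.

Lemma avoids_nil s : avoids s [::] = (s \notin C).
Proof. by rewrite /avoids /= andbT. Qed.

Section Value.
Variables (goal : pred S) (B K0 : nat).

(* Budget 0 stands for failure. *)
Definition entry (b : nat) (row : S -> nat) s : nat :=
  if s \in C then 0 else
  maxn (if goal s then b else 0) (\max_(t | e s t) row t).

Fixpoint padding_value m s : nat :=
  if m is m'.+1 then (entry B (padding_value m') s).-1 else K0.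

(* The largest budget left to a path from s, where a walk reaching the goal
   starts with budget B and pays its distance to w, and a walk outlasting w and
   m further positions starts with budget K0. *)
Fixpoint value m w s : nat :=
  if w is a :: w' then
    let x := entry (B - size w') (value m w') s in
    if a == lab s then x else x.-1
  else padding_value m s.

(** Since 0 means failure, a positive threshold turns the maxima into the existence of a stop or of
    a successor. *)
Lemma leq_entry v b row s : 0 < v ->
  v <= entry b row s <->
  s \notin C /\ (goal s /\ v <= b \/ exists2 t, e s t & v <= row t).
Proof.
move=> v_gt0; rewrite /entry; case: (s \in C) => /=.
  by split=> [|[]//]; lia.
rewrite leq_max; split=> [/orP [|le_max]|[_ [[-> ->] //|[t est le]]]].
- by case: (goal s) => [le|]; [split; auto | lia].
- split=> //; right.
  case: (pickP (fun t => e s t && (v <= row t))) => [t /andP []|no]; first by exists t.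
  suff : \max_(t | e s t) row t <= v.-1 by lia.
  apply/bigmax_leqP => t est; have := no t; rewrite est /=; lia.
by apply/orP; right; apply: leq_trans le _; apply: leq_bigmax_cond.
Qed.

(** Soundness: the threshold is followed through the maxima until the walk either stops in a goal
    state or survives all positions. *)
Lemma value_path m w s v : 0 < v -> v <= value m w s ->
  (exists p, [/\ avoids s p, goal (last s p)
               & v + gen_hamming w (map lab (s :: p)) <= B])
  \/ v <= K0 /\ walk (size w + m) s.
Proof.
elim: w s v => [|a w IHw] s v v_gt0.
  elim: m s v v_gt0 => [|m IHm] s v v_gt0 /= le_v; first by right.
  have {}le_v : v.+1 <= entry B (padding_value m) s by lia.
  have [sC [[gs le]|[t est le]]] := (leq_entry _ _ _ (ltn0Sn v)).1 le_v.
    left; exists [::]; rewrite avoids_nil; split=> //.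
    by rewrite gen_hamming_nil /= addn1.
  have [|[p [av gl le']]|[le' wt]] := IHm t _ _ le => //.
    left; exists (t :: p); rewrite avoids_cons sC est av; split=> //.
    by move: le'; rewrite !gen_hamming_nil /=; lia.
  right; split; first lia.
  by rewrite sC; apply/existsP; exists t; rewrite est.
rewrite [value _ _ _]/= => le_v.
(* The price of a mismatch is moved into the threshold, so that both outcomes of the label test are
   treated together. *)
have {}le_v : v + (a != lab s) <= entry (B - size w) (value m w) s.
  by move: le_v; case: eqP => _ /=; lia.
have v'_gt0 : 0 < v + (a != lab s) by lia.
have [sC [[gs le]|[t est le]]] := (leq_entry _ _ _ v'_gt0).1 le_v.
  left; exists [::]; rewrite avoids_nil; split=> //.
  by rewrite /= gen_hamming_cons gen_hamming_nilr; lia.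
have [|[p [av gl le']]|[le' wt]] := IHw t _ _ le => //.
  left; exists (t :: p); rewrite avoids_cons sC est av; split=> //.
  by rewrite map_cons gen_hamming_cons; lia.
right; split; first lia.
by rewrite /= sC; apply/existsP; exists t; rewrite est.
Qed.

(** The converse for paths reaching the goal; the recursion only sees those with at most
    [size w + m] states. *)
Lemma path_value m w s p v : 0 < v -> avoids s p -> goal (last s p) ->
  size (s :: p) <= size w + m ->
  v + gen_hamming w (map lab (s :: p)) <= B -> v <= value m w s.
Proof.
move=> v_gt0; elim: w s p v v_gt0 => [|a w IHw] s p v v_gt0.
  elim: m s p v v_gt0 => [|m IHm] s p v v_gt0 av gl; rewrite gen_hamming_nil //.
  move=> sz le /=; suff : v.+1 <= entry B (padding_value m) s by lia.
  apply/leq_entry => //; split; first exact: avoids_notin av.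
  case: p av gl sz le => [|t p] av gl sz le; first by left; split=> //; move: le => /=; lia.
  move: av; rewrite avoids_cons => /and3P [_ est av]; right; exists t => //.
  by apply: (IHm t p); rewrite // gen_hamming_nil; move: le => /=; lia.
move=> av gl sz; rewrite map_cons gen_hamming_cons => le.
suff : v + (a != lab s) <= entry (B - size w) (value m w) s.
  by rewrite /=; case: eqP => _ /=; lia.
apply/leq_entry; first lia.
split; first exact: avoids_notin av.
case: p av gl sz le => [|t p] av gl sz le.
  by left; move: le; rewrite /= gen_hamming_nilr; split=> //; lia.
move: av; rewrite avoids_cons => /and3P [_ est av]; right; exists t => //.
by apply: (IHw t p) => //; [lia | rewrite -addnA].
Qed.

(** Every position is charged 1, matched or not; this crude bound suffices because only positivity
    of the value will matter. *)
Lemma walk_value m w s v : 0 < v -> walk (size w + m) s ->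
  v + (size w + m) <= K0 -> v <= value m w s.
Proof.
elim: w s v => [|a w IHw] s v v_gt0.
  elim: m s v v_gt0 => [|m IHm] s v v_gt0 /=; first by lia.
  case/andP=> sC /existsP [t /andP [est wt]] le.
  suff : v.+1 <= entry B (padding_value m) s by lia.
  apply/leq_entry => //; split=> //; right; exists t => //.
  by apply: IHm => //=; lia.
rewrite /= => /andP [sC /existsP [t /andP [est wt]]] le.
suff : v.+1 <= entry (B - size w) (value m w) s by case: eqP => _; lia.
apply/leq_entry => //; split=> //; right; exists t => //.
by apply: IHw => //; lia.
Qed.

End Value.

(* Beyond the end of w each position costs 1, so cycles there can be cut. *)
Lemma shorten_avoids w s p : avoids s p ->
  exists p', [/\ avoids s p', last s p' = last s p,
    size (s :: p') <= size w + #|S|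
    & gen_hamming w (map lab (s :: p')) <= gen_hamming w (map lab (s :: p))].
Proof.
elim: w s p => [|a w IHw] s p.
  case/andP=> pth; case/shortenP: pth => p' pth' un sub al.
  exists p'; rewrite !gen_hamming_nil !size_map; split=> //.
  - rewrite /avoids pth' /=; move: al => /= /andP [-> /allP al] /=.
    by apply/allP => x /sub /al.
  - by rewrite add0n -(card_uniqP un) max_card.
  by rewrite /= ltnS uniq_leq_size //; case/andP: un.
case: p => [|t p] av.
  by exists [::]; split=> //=; have : 0 < #|S| by [apply/card_gt0P; exists s]; lia.
move: av; rewrite avoids_cons => /and3P [sC est /IHw [p' [av' la sz le]]].
exists (t :: p'); rewrite avoids_cons sC est av'; split=> //.
by rewrite map_cons [map lab [:: s, t & p]]map_cons !gen_hamming_cons leq_add2l.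
Qed.

(** * Long walks and infinite paths *)

Lemma walkS n s : walk n.+1 s -> walk n s.
Proof.
elim: n s => // n IHn s; rewrite [walk n.+2 s]/= [walk n.+1 s]/=.
case/andP=> -> /existsP [t /andP [est wt]].
by apply/existsP; exists t; rewrite est; apply: IHn.
Qed.

Lemma walk_le m n s : m <= n -> walk n s -> walk m s.
Proof.
move/subnK <-; elim: (n - m) => // k IHk; rewrite addSn => /walkS; exact: IHk.
Qed.

(* The sets of starting points of walks of length k decrease with k, so they
   stabilise after at most #|S| steps. *)
Lemma walk_infinite n s : #|S| < n -> walk n s ->
  exists f : nat -> S, [/\ f 0 = s, forall i, e (f i) (f i.+1)
                         & forall i, f i \notin C].
Proof.
move=> ltn wn.
have [k k_le kE] : exists2 k, k < n & forall t, walk k t -> walk k.+1 t.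
  case: (pickP (fun k : 'I_n => [forall t, walk k t ==> walk k.+1 t])).
    by move=> k /forallP H; exists k => // t; apply/implyP.
  (* Otherwise every inclusion is strict and each step loses a state, which cannot happen more than
     [#|S|] times. *)
  move=> no; suff H k : k <= n -> #|[set t | walk k t]| + k <= #|S|.
    by have := H n (leqnn n); lia.
  elim: k => [|k IHk] k_le; first by rewrite addn0 max_card.
  have /forallPn [t] := negbT (no (Ordinal k_le)).
  rewrite negb_imply => /andP [wk wk1].
  have : #|[set u | walk k.+1 u]| < #|[set u | walk k u]|.
    apply: proper_card; apply/properP; split.
      by apply/subsetP => u; rewrite !inE; apply: walkS.
    by exists t; rewrite inE.
  by have := IHk (ltnW k_le); lia.
have step t : walk k t -> exists2 u, e t u & walk k u.
  by move=> /kE /= /andP [_ /existsP [u /andP [? ?]]]; exists u.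
pose next t := odflt t [pick u | e t u && walk k u].
have nextP t : walk k t -> e t (next t) && walk k (next t).
  move=> /step [u eu wu]; rewrite /next; case: pickP => [//|/(_ u)].
  by rewrite eu wu.
pose f i := iter i next s.
have wf i : walk k (f i).
  elim: i => [|i IHi]; first exact: walk_le (ltnW k_le) wn.
  by have /andP [] := nextP _ IHi.
exists f; split=> // i; first by have /andP [] := nextP _ (wf i).
(* [walk k] says nothing when [k] is 0, so avoidance of [C] is read off [walk k.+1]. *)
by have /= /andP [] := kE _ (wf i).
Qed.

Lemma infinite_walk (f : nat -> S) n i : (forall i, e (f i) (f i.+1)) ->
  (forall i, f i \notin C) -> walk n (f i).
Proof.
move=> fe fC; elim: n i => //= n IHn i; rewrite fC.
by apply/existsP; exists (f i.+1); rewrite fe IHn.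
Qed.

End Budget.

(** * Correctness of the comparison of budgets *)

Lemma always_fin (S : finType) (A : {set S}) (u : seq S) :
  always A (Fin u) <-> all (mem A) u.
Proof.
rewrite /always /=; elim: u => [|s u IHu] /=; first by split=> // _ [|i] t.
split=> [H|/andP [sA /IHu H] [|i] t] /=; last exact: H.
  by rewrite (H 0 s) //; apply/IHu => i t; apply: (H i.+1).
by case=> <-.
Qed.

Lemma eventually_fin (S : finType) (A : {set S}) (u : seq S) :
  eventually A (Fin u) <-> has (mem A) u.
Proof.
rewrite /eventually /=; elim: u => [|s u IHu] /=; first by split=> // [[[|i] [t []]]].
split=> [[[|i] [t [/=]]]|/orP [sA|/IHu [i [t H]]]].
- by case=> -> ->.
- by move=> ut tA; apply/orP; right; apply/IHu; exists i, t.
- by exists 0, s.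
by exists i.+1, t.
Qed.

Section Correctness.
Variables (S AP : finType) (T : transition_system S AP) (E C : {set S}).
Variable (pi : seq S).
Hypotheses (E_terminal : E \subset terminal T) (pi_pos : 0 < size pi).

Let avoiding rho := maximal_path T rho /\ always (~: C) rho.
Let w := map (label T) pi.
Let d p := gen_hamming w (map (label T) (init T :: p)).
Let K := (#|S| + size pi).+1.
Let others : {set S} := terminal T :\: E.
Let run p := avoids (trans T) C (init T) p.
Let val (goal : {set S}) k0 :=
  value (trans T) C (label T) (mem goal) (K + K) k0 #|S| w (init T).

Lemma notin_predC p : all (mem (~: C)) p = all [predC C] p.
Proof. by apply: eq_all => s; rewrite /= !inE. Qed.

Lemma avoiding_fin p : run p -> last (init T) p \in terminal T ->
  avoiding (Fin (init T :: p)).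
Proof. by case/andP=> pth al ter; split=> //; apply/always_fin; rewrite notin_predC. Qed.

Lemma avoiding_cases rho : avoiding rho ->
  (exists p, [/\ rho = Fin (init T :: p), run p & last (init T) p \in terminal T]) \/
  (exists f, [/\ rho = Inf f, f 0 = init T, forall i, trans T (f i) (f i.+1)
              & forall i, f i \notin C]).
Proof.
case: rho => [[|s p]|f] [] //=.
  case=> -> pth ter /always_fin; rewrite notin_predC => al.
  by left; exists p; rewrite /run /avoids pth.
case=> f0 ft al; right; exists f; split=> // i.
by have := al i (f i) erefl; rewrite inE.
Qed.

Lemma in_terminal t s : s \in terminal T -> trans T s t = false.
Proof. by rewrite inE => /forallP /(_ t) /negPf. Qed.

(** Target states are terminal, so a path can only meet one at its end. *)
Lemma has_target s p : path (trans T) s p -> has (mem E) (s :: p) = (last s p \in E).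
Proof.
elim: p s => [|t p IHp] s; first by rewrite /= orbF.
rewrite [path _ _ _]/= => /andP [st /IHp IH].
rewrite [has _ _]/= -/(has _ (t :: p)) IH /=.
by case: (boolP (s \in E)) => // /(subsetP E_terminal) /(in_terminal t); rewrite st.
Qed.

Lemma property_fin o p : run p -> 
  property o E (Fin (init T :: p)) <->
  (if o is Reachability then last (init T) p \in E else last (init T) p \notin E).
Proof.
case/andP=> /has_target hE _; case: o; first by rewrite [property _ _]/= eventually_fin hE.
rewrite [property _ _]/= always_fin -hE -all_predC.
by rewrite (eq_all (a2 := predC (mem E))) // => s; rewrite /= !inE.
Qed.

Lemma property_inf o f : (forall i, trans T (f i) (f i.+1)) ->
  property o E (Inf f) <-> o = Safety.
Proof.
move=> ft; have fE i : f i \notin E.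
  by apply/negP => /(subsetP E_terminal) /(in_terminal (f i.+1)); rewrite ft.
case: o => /=; split=> //.
  by case=> i [s [[<-]]]; rewrite (negPf (fE i)).
by move=> _ i s [<-]; rewrite inE fE.
Qed.

(** The path is first shortened to fit in the recursion; its distance is then below [K], so more
    than [K] of the budget [K + K] remains. *)
Lemma run_value (goal : {set S}) k0 p : run p -> last (init T) p \in goal ->
  K + K <= val goal k0 + d p /\ K < val goal k0.
Proof.
move=> /(shorten_avoids (label T) w) [p' [av la sz le]] gl.
have gh_le := gen_hamming_le w (map (label T) (init T :: p')).
have sw : size w = size pi by apply: size_map.
rewrite sw [size (map _ (_ :: _))]size_map in gh_le; rewrite sw in sz.
have d_lt : gen_hamming w (map (label T) (init T :: p')) < K.
  by rewrite /K; move: gh_le sz; lia.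
have le_v : (K + K) - gen_hamming w (map (label T) (init T :: p')) <= val goal k0.
  apply: (@path_value _ _ _ _ _ _ _ _ _ _ _ p') => //; [lia | by rewrite la | by rewrite sw |].
  by rewrite subnK // (leq_trans (ltnW d_lt)) ?leq_addl.
have {}le : gen_hamming w (map (label T) (init T :: p')) <= d p by exact: le.
by move: le d_lt le_v; move: (gen_hamming _ _) (val _ _) (d p) => x y z; lia.
Qed.

(** The value itself is taken as the threshold, so a path obtained here is an optimal one. *)
Lemma value_run (goal : {set S}) k0 : 0 < val goal k0 ->
  (exists p, [/\ run p, last (init T) p \in goal & val goal k0 + d p <= K + K]) \/
  val goal k0 <= k0 /\ walk (trans T) C (size pi + #|S|) (init T).
Proof.
move=> v_gt0; have [[p [? ? ?]]|] := value_path v_gt0 (leqnn _).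
  by left; exists p.
by rewrite size_map; right.
Qed.

(** [K] exceeds the number of positions by one, so a surviving walk keeps at least budget 1. *)
Lemma walk_value_gt0 (goal : {set S}) :
  walk (trans T) C (size pi + #|S|) (init T) -> 0 < val goal K.
Proof.
by move=> wk; apply: walk_value; rewrite // size_map // /K; lia.
Qed.

(** [good] and [bad] collect the terminal states whose paths satisfy or violate the property. The
    budget [K] for survivors goes to the side where infinite paths belong. *)
Lemma compare_values o : let good := if o is Reachability then E else others in
  let bad := if o is Reachability then others else E in
  let k_good := if o is Reachability then 0 else K in
  let k_bad := if o is Reachability then K else 0 in
  counterfactual_cause T (d_gHamm T) C (property o E) (Fin pi) <->
  val good k_good < val bad k_bad.
Proof.
move=> good bad kg kb.
have kb_le : kb <= K by rewrite /kb; case: (o).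
have kg_le : kg <= K by rewrite /kg; case: (o).
have goodP p : run p -> last (init T) p \in terminal T ->
    property o E (Fin (init T :: p)) <-> last (init T) p \in good.
  move=> /(property_fin o) -> ter; rewrite /good; case: (o) => //.
  by rewrite inE ter andbT.
have badP p : last (init T) p \in terminal T -> 
    (last (init T) p \in bad) = (last (init T) p \notin good).
  by move=> ter; rewrite /bad /good; case: (o); rewrite in_setD ter andbT ?negbK.
have sub_good : good \subset terminal T by rewrite /good; case: (o); rewrite ?subsetDl.
have sub_bad : bad \subset terminal T by rewrite /bad; case: (o); rewrite ?subsetDl.
have lastP (g : {set S}) p : g \subset terminal T -> last (init T) p \in g ->
    last (init T) p \in terminal T by move=> sub gp; apply: (subsetP sub).
rewrite /counterfactual_cause -/avoiding; split.
  case=> [[rho0 av0] cause]; rewrite ltnNge; apply/negP => le_v.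
  (* By [le_v], the good value dominates every finite avoiding path, good or bad. *)
  have run_ge p : run p -> last (init T) p \in terminal T ->
      K + K <= val good kg + d p /\ K < val good kg.
    move=> rp ter; case: (boolP (last (init T) p \in good)) => [|].
      exact: run_value.
    by rewrite -badP // => /(run_value kb rp) []; lia.
  have : (exists p, [/\ run p, last (init T) p \in good & val good kg + d p <= K + K])
      \/ val good kg <= kg.
    by case: (posnP (val good kg)) => [->|/value_run [|[]]]; auto.
  (* A good path attaining the value is closest to [pi] and satisfies the property, against
     [cause]. *)
  case=> [[p [rp gp le_d]]|le_kg].
    have ter := lastP _ _ sub_good gp.
    apply: (cause (Fin (init T :: p))); last exact/goodP.
      exact: avoiding_fin.
    move=> rho' /avoiding_cases [[p' [-> rp' ter']]|[f [-> _ _ _]]] //=.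
    by have [] := run_ge p' rp' ter'; rewrite -/w -/(d p) -/(d p'); lia.
  (* A finite avoiding path would push the good value above [K], so only infinite ones remain. *)
  have no_run p : run p -> last (init T) p \in terminal T -> False.
    by move=> rp /(run_ge _ rp) [_]; lia.
  have [[p [_ rp /no_run]]|[f [rhoE f0 ft fC]]] := avoiding_cases av0; first by apply.
  (* For reachability, the infinite path makes the bad value positive while the good one is 0. For
     safety, it satisfies the property and is minimal, since all avoiding paths are at infinite
     distance. *)
  have [oE|oE] : o = Reachability \/ o = Safety by case: (o); auto.
    have : 0 < val bad kb.
      by rewrite /kb oE; apply: walk_value_gt0; rewrite -f0; apply: infinite_walk.
    by have kg0 : kg = 0 by [rewrite /kg oE]; lia.
  apply: (cause rho0); rewrite // rhoE; last exact/(property_inf o ft).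
  by move=> rho' /avoiding_cases [[p [_ rp /no_run]]|[g [-> _ _ _]]] //; case.
move=> lt_v; have v_gt0 : 0 < val bad kb by lia.
have [[p [rp bp le_d]]|[le_kb wk]] := value_run v_gt0; split.
- by exists (Fin (init T :: p)); apply: avoiding_fin => //; apply: lastP bp.
(* A good path at most as far from [pi] as [p] would make the good value at least the bad one. *)
- move=> rho av min_rho; have := min_rho _ (avoiding_fin rp (lastP _ _ sub_bad bp)).
  have [[q [-> rq ter]]|[f [-> _ _ _]]] // := avoiding_cases av.
  rewrite /= -/w -/(d p) -/(d q) => le_dq /(goodP _ rq ter) gq.
  by have [] := run_value kg rq gq; lia.
(* As [pi] is nonempty, the walk has more than [#|S|] steps. *)
- have [|f [f0 ft fC]] := walk_infinite _ wk; first by lia.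
  by exists (Inf f); split=> // i s [<-]; rewrite inE fC.
(* A positive value at most [kb] forces reachability. A finite good path would bring the good value
   above [K], hence above the bad one, and infinite paths violate reachability. *)
move=> rho av _; have oE : o = Reachability.
  have [//|oS] : o = Reachability \/ o = Safety by case: (o); auto.
  by have kb0 : kb = 0 by [rewrite /kb oS]; lia.
have [[q [-> rq ter]]|[f [-> _ ft _]]] := avoiding_cases av.
  by move=> /(goodP _ rq ter) gq; have [] := run_value kg rq gq; lia.
by move/(property_inf o ft); rewrite oE.
Qed.

End Correctness.

(** * The algorithm computes the budgets *)

Lemma eq_bits_enum (X : finType) (A B : {set X}) :
  eq_bits [seq x \in A | x <- enum X] [seq x \in B | x <- enum X] = (A == B).
Proof.
rewrite /eq_bits zip_map all_map; apply/allP/eqP => [eqAB|-> x _ //=].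
by apply/setP => x; apply/eqP/(eqAB x)/mem_enum.
Qed.

Lemma max_entry_enum (S : finType) (P : pred S) (row : S -> nat) :
  max_entry [seq P t | t <- enum S] [seq row t | t <- enum S] = \max_(t | P t) row t.
Proof.
have -> : \max_(t | P t) row t = \max_(t <- enum S | P t) row t.
  by rewrite big_enum_cond; apply: eq_bigl => t; rewrite inE.
rewrite /max_entry zip_map.
suff H m : foldl (fun z p => if p.1 then maxn z p.2 else z) m
    [seq (P t, row t) | t <- enum S] = maxn m (\max_(t <- enum S | P t) row t).
  by rewrite H max0n.
elim: (enum S) m => [|t s IHs] m; first by rewrite big_nil maxn0.
by rewrite big_cons /= IHs; case: (P t); rewrite ?maxnA.
Qed.

Lemma nth_enum_index (S : finType) (A : Type) (d : A) (f : S -> A) s :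
  nth d [seq f t | t <- enum S] (index s (enum S)) = f s.
Proof. by rewrite (nth_map s) ?nth_index ?index_mem ?mem_enum. Qed.

Section Implementation.
Variables (S AP : finType) (T : transition_system S AP) (C goal : {set S}).
Variables (b k0 : nat).

Let data : seq state_data :=
  [seq ([seq trans T s t | t <- enum S],
       ([seq p \in label T s | p <- enum AP], (s \in C, s \in goal))) | s <- enum S].
Let bits (A : {set AP}) := [seq p \in A | p <- enum AP].

Lemma dp_entry_enum (a : word_letter) n row s :
  dp_entry a (n, [seq row t | t <- enum S])
    ([seq trans T s t | t <- enum S], (bits (label T s), (s \in C, s \in goal))) =
  let x := entry (trans T) C (mem goal) n row s in
  if a.1 && eq_bits a.2 (bits (label T s)) then x else x.-1.
Proof. by rewrite /dp_entry /entry /= max_entry_enum; case: (s \in C); case: ifP. Qed.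

(** Reading the word from its end makes the left fold compute the recursion of [value] from the
    innermost call outwards. *)
Lemma dp_value m (w : seq {set AP}) :
  dp data b k0 (nseq m (false, [::]) ++ rev [seq (true, bits A) | A <- w]) =
  (b - size w, [seq value (trans T) C (label T) (mem goal) b k0 m w s | s <- enum S]).
Proof.
rewrite /dp foldl_cat foldl_rev.
pose row i := [seq padding_value (trans T) C (mem goal) b k0 i s | s <- enum S].
have -> : [seq k0 | _ <- data] = row 0 by rewrite /data -map_comp.
have -> : foldl (dp_step data) (b, row 0) (nseq m (false, [::])) = (b, row m).
  rewrite -[in RHS](add0n m); elim: m 0 => [|m IHm] i /=; first by rewrite addn0.
  rewrite -[i + m.+1]addSnnS -IHm; congr (foldl _ (_, _) _).
  by rewrite /data -map_comp; apply: eq_map => s /=; rewrite dp_entry_enum.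
elim: w => [|A w IHw]; first by rewrite subn0.
rewrite [foldr _ _ _]/= IHw /dp_step /= /data -map_comp; congr (_, _); first by lia.
apply: eq_map => s /=; rewrite dp_entry_enum /=.
by rewrite eq_bits_enum.
Qed.

End Implementation.

(** * Instances as nested tuples of encodable data *)

Definition raw_of (x : instance) : raw_instance :=
  let S := states x in let T := system x in
  (index (init T) (enum S),
  ([seq [seq trans T s t | t <- enum S] | s <- enum S],
  ([seq [seq p \in label T s | p <- enum (props x)] | s <- enum S],
  ([seq s \in targets x | s <- enum S],
  ([seq s \in cause x | s <- enum S],
  ((if objective_of x is Reachability then true else false),
  ([seq index s (enum S) | s <- execution x], tt))))))).

(** The final [tt] is encoded by [Nil], which closes the list of seven components, so nested pairs
    and list share one tree. *)
Lemma encode_instanceE x : encode_instance x = enc (raw_of x).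
Proof.
case: x => S AP T E C o p; rewrite /encode_instance /raw_of /enc /=.
rewrite /encodable_prod /enc /encodable_seq /enc /= /encodable_seq /enc.
by rewrite /encode_pred -!map_comp; do !congr Cons; congr encode_seq;
  apply: eq_map => s /=; rewrite -!map_comp.
Qed.

Section RawInstance.
Variables (S AP : finType) (T : transition_system S AP) (E C : {set S}).
Variables (o : objective) (p : seq S).
Let r := raw_of (Instance T E C o p).
Let K := (#|S| + size p).+1.

Lemma raw_boundE : raw_bound r = K.
Proof. by congr (_ + _).+1; rewrite ?cardE; apply: size_map. Qed.

Lemma raw_othersE : raw_others r = [seq s \in terminal T :\: E | s <- enum S].
Proof.
rewrite /raw_others /= zip_map -map_comp; apply: eq_map => s /=.
rewrite !inE all_map; congr (_ && _).
apply/allP/forallP => [H t|H t _ /=]; last exact: H.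
exact: H (mem_enum _ t).
Qed.

Lemma raw_valueE (goal : {set S}) k0 :
  raw_value r [seq s \in goal | s <- enum S] k0 =
  value (trans T) C (label T) (mem goal) (K + K) k0 #|S| (map (label T) p) (init T).
Proof.
rewrite /raw_value raw_boundE.
have -> : raw_data r [seq s \in goal | s <- enum S] =
    [seq ([seq trans T s t | t <- enum S],
         ([seq q \in label T s | q <- enum AP], (s \in C, s \in goal))) | s <- enum S].
  by rewrite /raw_data /= !zip_map.
have -> : raw_word r = nseq #|S| (false, [::]) ++
    rev [seq (true, [seq q \in A | q <- enum AP]) | A : {set AP} <- map (label T) p].
  have sz : size r.2.1 = #|S| by rewrite cardE; apply: size_map.
  rewrite -sz /raw_word; congr (_ ++ rev _).
    by elim: r.2.1 => //= a l ->.
  rewrite -[r.2.2.2.2.2.2.1]/([seq index s (enum S) | s <- p]).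
  rewrite -[LHS]map_comp -[RHS]map_comp; apply: eq_map => s; congr (_, _).
  exact: (nth_enum_index _ (fun s => [seq q \in label T s | q <- enum AP])).
by rewrite dp_value; apply: nth_enum_index.
Qed.

Lemma decideP : E \subset terminal T -> 0 < size p ->
  decide r <->
  counterfactual_cause T (d_gHamm T) C (property o E) (Fin p).
Proof.
move=> ET p_gt0; have /= H := compare_values C ET p_gt0 o.
rewrite /decide raw_othersE raw_boundE.
have -> : r.2.2.2.1 = [seq s \in E | s <- enum S] by [].
rewrite !raw_valueE /=; case: o H => H; exact: iff_sym.
Qed.

End RawInstance.

(** * Polynomial-time decidability *)

Lemma ptime_ptime_decidable (I X : Type) {eX : encodable X} (encode : I -> tree)
    (h : I -> X) (f : X -> bool) (P Q : I -> Prop) :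
  (forall x, encode x = enc (h x)) -> ptime f ->
  (forall x, P x -> f (h x) <-> Q x) -> ptime_decidable encode P Q.
Proof.
(* For a positive size [n], [n.+1 ^ k] is at most [2 ^ k * n ^ k], whence the coefficient. *)
move=> encE [_ /(_ 0) [c [t [[k tk] ct]]]] fP; exists c, (2 ^ k), k => x Px.
have [|n [tau [ex le_n tau0 _]]] := ct (input_store (encode x)) (h x).
  by rewrite /input_store update_eq encE.
exists n, tau; split=> //; last first.
  by rewrite /accepting tau0 -(fP x Px); case: (f (h x)).
apply: leq_trans le_n (leq_trans (tk _) _); rewrite -expnMn encE.
apply: leq_trans (leq_addr _ _).
case: (posnP k) => [->//|k_gt0]; rewrite leq_exp2r //.
by rewrite mul2n -addnn -addn1 leq_add2l tree_size_gt0.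
Qed.

Theorem theorem3 :
  ptime_decidable encode_instance
    (fun x : instance =>
       let T := system x in
       let E := targets x in
       let C := cause x in
       let Phi := property (objective_of x) E in
       let pi := Fin (execution x) in
       [/\ E \subset terminal T,
           [disjoint C & E],
           maximal_path T pi,
           eventually C pi
         & Phi pi])
    (fun x : instance =>
       let T := system x in
       let E := targets x in
       let C := cause x in
       let Phi := property (objective_of x) E in
       let pi := Fin (execution x) in
       counterfactual_cause T (d_gHamm T) C Phi pi).
Proof.
apply: (ptime_ptime_decidable encode_instanceE ptime_decide) => x.
case: x => S AP T E C o p /= [ET _ mp _ _].
by apply: decideP => //; case: p mp.
Qed.
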